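(* Let $M(x)$ be the generating function of the Motzkin numbers and $F(x,7)=M(x)^7$; write $H_m$ for $H_m(F(x,7))$. For every integer $n\ge 0$, \begin{align*} H_{21n}&=H_{21n+1}=(-1)^n,\\ H_{21n+2}&=(-1)^{n+1}\tfrac{7}{30}(2n+1)(374556n^4+385532n^3+127449n^2+13363n+60),\\ H_{21n+3}&=(-1)^n\tfrac{49}{180}(29647548n^6+54252996n^5+27993259n^4+2344748n^3-1393217n^2-227934n-1080)(2n+1)^2,\\ H_{21n+4}&=(-1)^{n+1}\tfrac{343}{180}(2n+1)^3(4235364n^6+12706092n^5+12161065n^4+3145310n^3-906059n^2-361032n+3420),\\ H_{21n+5}&=(-1)^{n+1}\tfrac{49}{180}(29647548n^6+123632292n^5+201441499n^4+160049288n^3+61715353n^2+9000600n-123300)(2n+1)^2,\\ H_{21n+6}&=(-1)^{n+1}\tfrac{7}{30}(374556n^4+1112692n^3+1218189n^2+583163n+103170)(2n+1),\\ H_{21n+7}&=H_{21n+8}=(-1)^{n+1},\\ H_{21n+9}&=(-1)^n\tfrac{7}{30}(n+1)(749112n^4+1850828n^3+1698242n^2+686273n+103230),\\ H_{21n+10}&=(-1)^{n+1}\tfrac{49}{180}(n+1)^2(118590192n^6+375938976n^5+459474568n^4+261223312n^3+59779951n^2-1682814n-1959840),\\ H_{21n+11}&=(-1)^n\tfrac{343}{90}(n+1)^3(16941456n^6+84707280n^5+148881208n^4+115228792n^3+34672057n^2-1047963n-1697400),\\ H_{21n+12}&=(-1)^n\tfrac{2401}{15}(n+1)^4(115248n^4+460992n^3+587608n^2+288512n+43695),\\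 H_{21n+13}&=H_{21n+16}=(-1)^{n+1}\,537824\,(n+1)^5,\\ H_{21n+14}&=H_{21n+15}=0,\\ H_{21n+17}&=(-1)^n\tfrac{2401}{15}(n+1)^4(115248n^4+460992n^3+587608n^2+217952n-26865),\\ H_{21n+18}&=(-1)^{n+1}\tfrac{343}{90}(n+1)^3(16941456n^6+118590192n^5+318295768n^4+398162632n^3+205815337n^2-2633505n-27024030),\\ H_{21n+19}&=(-1)^{n+1}\tfrac{49}{180}(n+1)^2(118590192n^6+1047143328n^5+3815496328n^4+7351444912n^3+7906357711n^2+4503507834n+1062057240),\\ H_{21n+20}&=(-1)^{n+1}\tfrac{7}{30}(n+1)(749112n^4+4142068n^3+8571962n^2+7868343n+2702820). \end{align*}
   Context: The Motzkin numbers are $M_n=\sum_{k\ge 0}\binom{n}{2k}C_k$, where $C_k=\frac{1}{k+1}\binom{2k}{k}$ is the $k$-th Catalan number; equivalently $M(x)=\sum_{n\ge0}M_nx^n=\frac{1-x-\sqrt{1-2x-3x^2}}{2x^2}$. For a formal power series $A(x)=\sum_{n\ge 0}a_nx^n$, its Hankel determinants are $H_n(A(x))=\det(a_{i+j})_{0\le i,j\le n-1}$ for $n\ge1$, and $H_0(A(x))=1$.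
   Formalization: The sign of H_{21n+13} is corrected: the formal statement has H_{21n+13} = (-1)^n 537824 (n+1)^5 (e.g. H_13 = 537824), instead of the printed (-1)^{n+1} 537824 (n+1)^5; H_{21n+16} is as printed. *)

(* Defs.v *)
From mathcomp Require Import all_boot all_order all_algebra.

Set Implicit Arguments.
Unset Strict Implicit.
Unset Printing Implicit Defensive.

Import Order.TTheory GRing.Theory Num.Theory.
Local Open Scope ring_scope.

(* A formal power series over R is represented by its coefficient sequence
   nat -> R; products are Cauchy products. *)
Definition fps_one (R : nzRingType) : nat -> R := fun n => (n == 0%N)%:R.

Definition fps_mul (R : nzRingType) (a b : nat -> R) : nat -> R :=
  fun n => \sum_(i < n.+1) a i * b (n - i)%N.

Definition fps_exp (R : nzRingType) (a : nat -> R) (m : nat) : nat -> R :=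
  iter m (fps_mul a) (@fps_one R).

(* For n = 0 this is the determinant of the empty matrix, i.e. 1 (det_mx00). *)
Definition hankel (R : comNzRingType) (a : nat -> R) (n : nat) : R :=
  \det (\matrix_(i < n, j < n) a (i + j)%N).

Definition catalan (k : nat) : rat := k.+1%:R^-1 * 'C(2 * k, k)%:R.

(* Coefficient sequence of the generating function M(x).  The sum over all
   k >= 0 is finite: 'C(n, 2 * k) = 0 as soon as k > n. *)
Definition motzkin (n : nat) : rat :=
  \sum_(k < n.+1) 'C(n, 2 * k)%:R * catalan k.

(* Main.v *)
From HB Require Import structures.
From Stdlib Require Import ZArith.
Require Import Defs.
From mathcomp Require Import all_boot all_order all_algebra all_fingroup.
From mathcomp Require Import ring zify ssrZ.

(* Let L be the functional on polynomials whose moments are the Motzkin numbers,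
   and V_k = U_k((x - 1) / 2) its orthonormal polynomials. As L(x^n V_k) counts
   Motzkin paths ending at height k, the coefficients of M^7 are the moments
   L(x^n q) with q = x^6 V_6. By Christoffel's theorem the Hankel determinant of
   order N is then the 12 x 12 determinant of the classes of V_N, ..., V_(N+11)
   modulo q. Modulo V_6 the V_m are, up to sign, basis vectors or 0, of period 14
   in m; modulo x^6 their coefficients are polynomials in k along each progression
   m = 3k + s. For N = 21n + r the determinant is therefore a polynomial in n for
   each parity of n, which is computed by evaluation inside the kernel. *)

Import Order.TTheory GRing.Theory Num.Theory.
Local Open Scope ring_scope.

(** * Motzkin paths and the powers of M *)

(* Motzkin paths of length n ending at height k. *)
Fixpoint motz (n k : nat) : rat :=
  if n is n'.+1 then
    motz n' k + motz n' k.+1 + (if k is k'.+1 then motz n' k' else 0)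
  else (k == 0%N)%:R.

(* Dyck prefixes with j down steps ending at height k. *)
Definition ballot (j k : nat) : rat :=
  'C(2 * j + k, j)%:R - (if j is j'.+1 then 'C(2 * j + k, j')%:R else 0).

Lemma ballot0 k : ballot 0 k = 1.
Proof. by rewrite /ballot bin0 subr0. Qed.

Lemma ballotS0 j : ballot j.+1 0 = ballot j 1.
Proof.
rewrite /ballot addn0 mulnS add2n binS natrD.
have -> : 'C((2 * j).+1, j.+1) = 'C((2 * j).+1, j).
  by rewrite -bin_sub; [congr 'C(_, _) |]; lia.
case: j => [|j]; first by rewrite !bin0; ring.
rewrite [in X in X = _](binS _.+1 j) natrD addn1; ring.
Qed.

(** By the last step of the prefix: up from height k or down from height k + 2. *)
Lemma ballotSS j k : ballot j.+1 k.+1 = ballot j.+1 k + ballot j k.+2.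
Proof.
rewrite /ballot.
have -> : (2 * j.+1 + k.+1)%N = (2 * j.+1 + k).+1 by lia.
have -> : (2 * j + k.+2)%N = (2 * j.+1 + k)%N by lia.
rewrite binS natrD.
case: j => [|j]; first by rewrite !bin0; ring.
rewrite [in X in X = _](binS _ j) natrD; ring.
Qed.

(** Choose which 2j + k steps are not level; they form a Dyck prefix with j down steps. For j >= K >
    n the binomial vanishes. *)
Lemma motz_ballot n k K :
  (n < K)%N -> motz n k = \sum_(j < K) 'C(n, 2 * j + k)%:R * ballot j k.
Proof.
elim: n k K => [|n IH] k [//|K] ltnK.
  rewrite big_ord_recl big1 => [|j _]; last first.
    by rewrite bin_small ?mul0r //= /bump; lia.
  by rewrite bin0n ballot0 muln0 add0n /= mulr1 addr0.
have IHK k' := IH k' K ltnK; have IHS k' := IH k' K.+1 (ltnW ltnK).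
rewrite /= (IHS k) (IHK k.+1).
case: k => [|k].
  rewrite addr0 [LHS]addrC 2!big_ord_recl !bin0 !ballot0 addrCA; congr +%R.
  rewrite -big_split /=; apply: eq_bigr => j _.
  rewrite /bump /= add1n ballotS0.
  have -> : (2 * j.+1 + 0)%N = (2 * j + 1).+1 by lia.
  rewrite binS natrD; ring.
rewrite (IHS k) addrAC -addrA [X in _ = X]big_ord_recl.
rewrite [in LHS]big_ord_recl [X in _ + (X + _) = _]big_ord_recl.
rewrite !ballot0 !muln0 !add0n !mulr1 binS natrD -!addrA; congr +%R.
rewrite addrCA; congr +%R.
rewrite -!big_split /=; apply: eq_bigr => j _.
rewrite /bump /= add1n ballotSS.
have -> : (2 * j.+1 + k.+1)%N = (2 * j.+1 + k).+1 by lia.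
have -> : (2 * j + k.+2)%N = (2 * j.+1 + k)%N by lia.
rewrite binS natrD; ring.
Qed.

Lemma catalan_ballot k : catalan k = ballot k 0.
Proof.
rewrite /catalan /ballot addn0; case: k => [|k]; first by rewrite !bin0; field.
have := mul_bin_left (2 * k.+1) k.
have -> : (2 * k.+1 - k = k.+2)%N by lia.
move/(congr1 (fun m => m%:R : rat)); rewrite !natrM => eq_bin.
have k2 : k.+2%:R != 0 :> rat by rewrite pnatr_eq0.
apply: (mulfI k2); rewrite mulrA divff // mul1r mulrBr -eq_bin.
by rewrite -mulrBl -natrB // subSnn mul1r.
Qed.

Lemma motz0 n : motz n 0 = motzkin n.
Proof.
rewrite (motz_ballot _ _ _ (ltnSn n)) /motzkin; apply: eq_bigr => j _.
by rewrite addn0 catalan_ballot.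
Qed.

Lemma motz_small n k : (n < k)%N -> motz n k = 0.
Proof.
elim: n k => [|n IH] [|k] //= ltnk.
by rewrite !IH ?addr0 //; lia.
Qed.

Lemma motz_diag n : motz n n = 1.
Proof. by elim: n => //= n ->; rewrite !motz_small ?add0r. Qed.

(* Last passage at height 0: the generating function of column k of motz is
   x^k M(x)^(k+1). *)
Lemma motz_conv k n :
  \sum_(i < n.+1) motzkin i * motz (n - i) k = motz n.+1 k.+1.
Proof.
elim: n k => [|n IH] k.
  by rewrite big_ord1 subnn -motz0 mul1r /= !add0r.
rewrite big_ord_recr subnn /=.
rewrite (eq_bigr (fun i : 'I_n.+1 => motzkin i * motz (n - i) k
    + motzkin i * motz (n - i) k.+1
    + motzkin i * (if k is k'.+1 then motz (n - i) k' else 0))); last first.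
  by move=> i _; rewrite subSn ?leq_ord // -!mulrDr.
rewrite !big_split /= !IH.
rewrite -[LHS]addrA; congr +%R.
case: k => [|k] /=.
  by rewrite big1 => [|i _]; rewrite ?mulr0 // mulr1 add0r -motz0.
by rewrite IH mulr0 addr0.
Qed.

(** Iteration of [motz_conv]; the argument [n + k] compensates the factor x^k. *)
Lemma fps_exp_motzkin k n : fps_exp motzkin k.+1 n = motz (n + k) k.
Proof.
elim: k n => [|k IH] n.
  rewrite addn0 /fps_exp /= /fps_mul big_ord_recr subnn /= big1 => [|i _].
    by rewrite add0r /fps_one /= mulr1 motz0.
  by rewrite /fps_one subn_eq0 leqNgt ltn_ord mulr0.
rewrite addnS -motz_conv [LHS]/fps_mul -addSn big_split_ord /=.
(* For i > n the remaining n + k - i steps cannot reach height k. *)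
rewrite [X in _ = _ + X]big1 ?addr0 => [|i _]; last first.
  by rewrite motz_small ?mulr0 //; case: i => i /= ?; lia.
by apply: eq_bigr => i _; rewrite -addnBAC ?leq_ord // -IH.
Qed.

(** * Determinants of linear functionals *)

Lemma scalar_coef (R : comNzRingType) (f : {poly R} -> R) (p : {poly R}) K :
  scalar f -> (size p <= K)%N -> f p = \sum_(j < K) p`_j * f 'X^j.
Proof.
move=> lin_f le_pK.
pose L : {scalar {poly R}} := HB.pack f (GRing.isLinear.Build _ _ _ _ f lin_f).
rewrite -[LHS]/(L p) -[in LHS](coefK p) (poly_def (size p)).
rewrite linear_sum (big_ord_widen K (fun i => L (p`_i *: 'X^i))) // big_mkcond.
apply: eq_bigr => j _; rewrite linearZ /=.
by case: ltnP => // le_pj; rewrite nth_default // mul0r.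
Qed.

(** The matrix of coefficients of the [b k] is unitriangular. *)
Lemma det_monic_basis (R : comNzRingType) K (b : nat -> {poly R})
    (psi : 'I_K -> {poly R} -> R) :
    (forall k, b k \is monic) -> (forall k, size (b k) = k.+1) ->
    (forall j, scalar (psi j)) ->
  \det (\matrix_(k < K, j < K) psi j (b k)) =
  \det (\matrix_(k < K, j < K) psi j 'X^k).
Proof.
move=> b_monic size_b lin_psi.
have -> : \matrix_(k < K, j < K) psi j (b k) =
    (\matrix_(k < K, i < K) (b k)`_i) *m \matrix_(i < K, j < K) psi j 'X^i.
  apply/matrixP => k j; rewrite !mxE (scalar_coef _ _ _ K (lin_psi j)).
    by apply: eq_bigr => i _; rewrite !mxE.
  by rewrite size_b.
rewrite det_mulmx det_trig.
  rewrite big1 ?mul1r // => i _; rewrite mxE.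
  by have /monicP := b_monic i; rewrite /lead_coef size_b.
by apply/is_trig_mxP => i j lt_ij; rewrite mxE nth_default ?size_b.
Qed.

Lemma odd_permX (T : finType) (s : {perm T}) d :
  (s ^+ d)%g = odd d && s :> bool.
Proof.
elim: d => [|d IH]; first by rewrite expg0 odd_perm1.
by rewrite expgS odd_permM IH /=; case: (odd d); case: (odd_perm s).
Qed.

(** The row permutation is the d-th power of the cyclic shift, hence even for even d. *)
Lemma det_rot_rows (R : comNzRingType) K d (F : nat -> 'I_K -> R) :
  ~~ odd d ->
  \det (\matrix_(k < K, j < K) F ((k + d) %% K)%N j) =
  \det (\matrix_(k < K, j < K) F k j).
Proof.
move=> even_d; pose s : 'S_K := (perm (@ordS_inj K) ^+ d)%g.
have -> : \matrix_(k < K, j < K) F ((k + d) %% K)%N j =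
    row_perm s (\matrix_(k < K, j < K) F k j).
  apply/matrixP => k j; rewrite !mxE; congr F.
  rewrite {}/s; elim: d {even_d} => [|d IH].
    by rewrite expg0 perm1 addn0 modn_small.
  by rewrite expgSr permM permE /= -IH -[in RHS]addn1 modnDml addn1 addnS.
rewrite row_permE det_mulmx det_perm.
by rewrite odd_permX (negPf even_d) mul1r.
Qed.

(** * Orthogonal polynomials and Christoffel's theorem *)

(* U_k((x - 1) / 2), with U_k the Chebyshev polynomials of the second kind:
   orthonormal for the functional with the Motzkin numbers as moments. *)
Fixpoint cheb (k : nat) : {poly rat} :=
  if k is k1.+1 then
    if k1 is k2.+1 then ('X - 1) * cheb k1 - cheb k2 else 'X - 1
  else 1.

Lemma chebSS k : cheb k.+2 = ('X - 1) * cheb k.+1 - cheb k.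
Proof. by []. Qed.

Lemma cheb_ind (P : nat -> Prop) :
  P 0%N -> P 1%N -> (forall k, P k -> P k.+1 -> P k.+2) -> forall k, P k.
Proof.
move=> P0 P1 PSS k; suff [] : P k /\ P k.+1 by [].
by elim: k => // k [Pk PSk]; split=> //; apply: PSS.
Qed.

Lemma monic_size_cheb k : cheb k \is monic /\ size (cheb k) = k.+1.
Proof.
elim/cheb_ind: k => [||k [_ sz0] [mon1 sz1]].
- by rewrite monic1 size_poly1.
- by rewrite /= -polyC1 monicXsubC size_XsubC.
have monX : 'X - 1 \is @monic rat by rewrite -polyC1 monicXsubC.
have szM : size (('X - 1) * cheb k.+1) = k.+3.
  by rewrite size_monicM ?monic_neq0 // sz1 -polyC1 size_XsubC.
have ltM : (size (- cheb k)%R < size (('X - 1) * cheb k.+1)%R)%N.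
  by rewrite szM size_polyN sz0.
by rewrite chebSS monicE lead_coefDl // size_polyDl // -monicE monicMl.
Qed.

Definition mom (p : {poly rat}) : rat := \sum_(i < size p) p`_i * motzkin i.

Lemma momE (p : {poly rat}) K :
  (size p <= K)%N -> mom p = \sum_(i < K) p`_i * motzkin i.
Proof.
move=> le_pK; rewrite /mom (big_ord_widen K (fun i => p`_i * motzkin i)) //.
rewrite big_mkcond; apply: eq_bigr => i _.
by case: ltnP => // le_pi; rewrite nth_default // mul0r.
Qed.

Lemma mom_is_scalar : scalar mom.
Proof.
move=> a u v; set K := maxn (size (a *: u + v)) (maxn (size u) (size v)).
rewrite !(momE _ K) /K ?leq_max ?leqnn ?orbT // mulr_sumr -big_split /=.
by apply: eq_bigr => i _; rewrite coefD coefZ mulrDl mulrA.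
Qed.

HB.instance Definition _ := GRing.isLinear.Build _ _ _ _ mom mom_is_scalar.

Lemma momXn n : mom 'X^n = motzkin n.
Proof.
rewrite /mom size_polyXn big_ord_recr big1 /= => [|i _].
  by rewrite coefXn eqxx mul1r add0r.
by rewrite coefXn ltn_eqF // mul0r.
Qed.

(** The relation x V_(k+1) = V_(k+2) + V_(k+1) + V_k turns into the step recursion of [motz]. *)
Lemma mom_Xn_cheb n k : mom ('X^n * cheb k) = motz n k.
Proof.
elim/cheb_ind: k n => [||k IH0 IH1] n.
- by rewrite mulr1 momXn motz0.
- rewrite /= mulrBr mulr1 -exprSr linearB /= !momXn -!motz0 /=; ring.
rewrite chebSS mulrBr mulrBl mul1r mulrBr mulrA -exprSr !linearB /=.
by rewrite !IH1 !IH0 /=; ring.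
Qed.

(** Take i <= j: L(x^l V_j) vanishes for l < j, so only the leading term x^i of V_i can contribute,
    and only if i = j. *)
Lemma cheb_orthonormal i j : mom (cheb i * cheb j) = (i == j)%:R.
Proof.
wlog le_ij : i j / (i <= j)%N.
  move=> IH; case/orP: (leq_total i j) => /IH //.
  by rewrite mulrC eq_sym.
have [mon_i sz_i] := monic_size_cheb i.
have lin : scalar (fun p => mom (p * cheb j)).
  by move=> a u v; rewrite mulrDl -scalerAl linearP.
rewrite (scalar_coef _ _ _ i.+1 lin) ?sz_i // big_ord_recr big1 => [|l _] /=.
  move/monicP: mon_i; rewrite add0r lead_coefE sz_i /= => ->; rewrite mul1r.
  rewrite mom_Xn_cheb; case: eqVneq => [->|ne_ij]; first exact: motz_diag.
  by rewrite motz_small // ltn_neqAle ne_ij.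
by rewrite mom_Xn_cheb motz_small ?mulr0 // (leq_trans (ltn_ord l)).
Qed.

(* Both sides are determinants of the functionals p |-> mom (p * 'X^i), i < N,
   and phi_0, ..., phi_(d-1) on the polynomials of degree < N + d: on the left in
   the basis cheb 0, ..., cheb (d-1), q, 'X * q, ..., 'X^(N-1) * q, on the right in
   the basis of the cheb k. *)
Lemma christoffel N d (q : {poly rat}) (phi : 'I_d -> {poly rat} -> rat) :
  ~~ odd d -> q \is monic -> size q = d.+1 ->
  (forall j, scalar (phi j)) -> (forall j p, phi j (p * q) = 0) ->
  hankel (fun n => mom ('X^n * q)) N *
    \det (\matrix_(k < d, j < d) phi j (cheb k)) =
  \det (\matrix_(k < d, j < d) phi j (cheb (N + k)%N)).
Proof.
move=> even_d mon_q sz_q lin_phi phi_q.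
pose psi (j : 'I_(N + d)) p :=
  match split j with inl i => mom (p * 'X^i) | inr i => phi i p end.
have psi_l i p : psi (lshift d i) p = mom (p * 'X^i).
  by rewrite /psi -[lshift d i]/(unsplit (inl i)) unsplitK.
have psi_r i p : psi (rshift N i) p = phi i p.
  by rewrite /psi -[rshift N i]/(unsplit (inr i)) unsplitK.
have lin_psi j : scalar (psi j).
  case: (split_ordP j) => i -> a u v; rewrite ?psi_l ?psi_r; last exact: lin_phi.
  by rewrite mulrDl -scalerAl linearP.
pose b k := if (k < d)%N then cheb k else 'X^(k - d) * q.
have det_b : \det (\matrix_(k < N + d, j < N + d) psi j (b k)) =
    \det (\matrix_(k < N + d, j < N + d) psi j (cheb k)).
  rewrite !det_monic_basis // => k; try by case: (monic_size_cheb k).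
    rewrite /b; case: ifP => _; first by case: (monic_size_cheb k).
    by rewrite monicMl // monicXn.
  rewrite /b; case: ltnP => [_|le_dk]; first by case: (monic_size_cheb k).
  by rewrite size_monicM ?monicXn ?monic_neq0 // size_polyXn sz_q; lia.
have det_l : \det (\matrix_(k < N + d, j < N + d) psi j (b k)) =
    hankel (fun n => mom ('X^n * q)) N *
    \det (\matrix_(k < d, j < d) phi j (cheb k)).
  (* The rotation by d moves the multiples of q to the top; the [phi j] kill them, so the matrix
     becomes block lower triangular. *)
  rewrite -(det_rot_rows _ _ d (fun k j => psi j (b k))) //.
  rewrite /hankel -(det_lblock _ (\matrix_(k < d, j < N) mom (cheb k * 'X^j))).
  congr (\det _); apply/matrixP => i j.
  case: (split_ordP i) => k ->; case: (split_ordP j) => l ->.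
  - rewrite block_mxEul !mxE psi_l modn_small /= ?ltn_add2r // /b.
    rewrite ltnNge leq_addl addnK /=; congr mom; rewrite exprD; ring.
  - rewrite block_mxEur !mxE psi_r modn_small /= ?ltn_add2r // /b.
    by rewrite ltnNge leq_addl addnK /= phi_q.
  - rewrite block_mxEdl !mxE psi_l /= -addnA addnC -addnA [(d + N)%N]addnC.
    by rewrite modnDr modn_small ?ltn_addl // /b ltn_ord.
  - rewrite block_mxEdr !mxE psi_r /= -addnA addnC -addnA [(d + N)%N]addnC.
    by rewrite modnDr modn_small ?ltn_addl // /b ltn_ord.
rewrite -det_l det_b.
(* The factor 1 becomes the determinant of the unitriangular block of the [mom (cheb k * 'X^j)];
   below that block, orthogonality gives zeros. *)
rewrite -[RHS]mul1r -(det1 _ N).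
have -> : \det (1%:M : 'M[rat]_N) =
    \det (\matrix_(k < N, j < N) mom (cheb k * 'X^j)).
  rewrite det1 -det_tr det_trig; last first.
    apply/is_trig_mxP => i j lt_ij.
    by rewrite !mxE mulrC mom_Xn_cheb motz_small.
  by rewrite big1 // => i _; rewrite !mxE mulrC mom_Xn_cheb motz_diag.
rewrite -(det_ublock _ (\matrix_(k < N, j < d) phi j (cheb k))).
congr (\det _); apply/matrixP => i j.
case: (split_ordP i) => k ->; case: (split_ordP j) => l ->.
- by rewrite block_mxEul !mxE psi_l.
- by rewrite block_mxEur !mxE psi_r.
- by rewrite block_mxEdl !mxE psi_l mulrC mom_Xn_cheb motz_small // ltn_addr.
- by rewrite block_mxEdr !mxE psi_r.
Qed.

(** * Integer polynomials and computed determinants *)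

(* A sum of products of small constants, which ring and field can read. *)
Fixpoint prat (p : positive) : rat :=
  match p with
  | xH => 1
  | xO p => 2 * prat p
  | xI p => 2 * prat p + 1
  end.

Definition zrat (z : Z) : rat :=
  match z with Z0 => 0 | Zpos p => prat p | Zneg p => - prat p end.

Lemma zratE z : zrat z = (int_of_Z z)%:~R.
Proof.
have addE a b : (int_of_Z (Z.add a b))%:~R =
    (int_of_Z a)%:~R + (int_of_Z b)%:~R :> rat.
  by rewrite -rmorphD -(rmorphD int_of_Z).
have pratE p : prat p = (int_of_Z (Zpos p))%:~R.
  elim: p => [p IH|p IH|//].
    have -> : Zpos p~1 = Z.add (Z.add (Zpos p) (Zpos p)) (Zpos xH) by lia.
    by rewrite !addE -IH -[(int_of_Z (Zpos xH))%:~R]/(1 : rat) /=; ring.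
  have -> : Zpos p~0 = Z.add (Zpos p) (Zpos p) by lia.
  by rewrite addE -IH /=; ring.
case: z => [//|p|p]; first exact: pratE.
by rewrite /zrat pratE -rmorphN -(rmorphN int_of_Z).
Qed.

Lemma zratD a b : zrat (Z.add a b) = zrat a + zrat b.
Proof. by rewrite !zratE -rmorphD -(rmorphD int_of_Z). Qed.

Lemma zratM a b : zrat (Z.mul a b) = zrat a * zrat b.
Proof. by rewrite !zratE -rmorphM -(rmorphM int_of_Z). Qed.

Lemma zratN a : zrat (Z.opp a) = - zrat a.
Proof. by rewrite !zratE -rmorphN -(rmorphN int_of_Z). Qed.

(* Integer polynomials, constant coefficient first. *)
Notation zpoly := (seq Z).

Definition ev (x : rat) (p : zpoly) : rat :=
  foldr (fun c v => zrat c + x * v) 0 p.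

Fixpoint zpadd (p q : zpoly) : zpoly :=
  match p, q with
  | [::], _ => q
  | _, [::] => p
  | a :: p', b :: q' => Z.add a b :: zpadd p' q'
  end.

Definition zpscale (c : Z) (p : zpoly) : zpoly := [seq Z.mul c a | a <- p].

Definition zpopp : zpoly -> zpoly := zpscale (Zneg xH).

Definition zpsub (p q : zpoly) : zpoly := zpadd p (zpopp q).

Definition zpmul (p q : zpoly) : zpoly :=
  foldr (fun a r => zpadd (zpscale a q) (Z0 :: r)) [::] p.

Definition zpcomp (p q : zpoly) : zpoly :=
  foldr (fun a r => zpadd [:: a] (zpmul q r)) [::] p.

Definition zptrim (p : zpoly) : zpoly :=
  foldr (fun a r => if Z.eqb a Z0 && nilp r then [::] else a :: r) [::] p.

Definition zpzero (p : zpoly) : bool := all (Z.eqb Z0) p.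

Lemma ev_add x p q : ev x (zpadd p q) = ev x p + ev x q.
Proof.
elim: p q => [|a p IH] [|b q] //=; rewrite ?add0r ?addr0 //.
by rewrite IH zratD; ring.
Qed.

Lemma ev_scale x c p : ev x (zpscale c p) = zrat c * ev x p.
Proof.
by elim: p => [|a p IH] /=; rewrite ?mulr0 // IH zratM; ring.
Qed.

Lemma ev_opp x p : ev x (zpopp p) = - ev x p.
Proof. by rewrite ev_scale /=; ring. Qed.

Lemma ev_sub x p q : ev x (zpsub p q) = ev x p - ev x q.
Proof. by rewrite ev_add ev_opp. Qed.

Lemma ev_mul x p q : ev x (zpmul p q) = ev x p * ev x q.
Proof.
elim: p => [|a p IH]; first by rewrite mul0r.
rewrite -[zpmul _ _]/(zpadd (zpscale a q) (Z0 :: zpmul p q)) ev_add ev_scale /= IH.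
by ring.
Qed.

Lemma ev_comp x p q : ev x (zpcomp p q) = ev (ev x q) p.
Proof.
elim: p => [//|a p IH].
rewrite -[zpcomp _ _]/(zpadd [:: a] (zpmul q (zpcomp p q))) ev_add ev_mul IH /=.
by ring.
Qed.

Lemma ev_zero x p : zpzero p -> ev x p = 0.
Proof.
elim: p => [//|[] // p IH] /= p0; rewrite IH //; ring.
Qed.

Lemma ev_trim x p : ev x (zptrim p) = ev x p.
Proof.
elim: p => [//|a p IH] /=; rewrite -IH; case: ifP => // /andP[].
by case: a => // _ /nilP ->; rewrite /= mulr0 addr0.
Qed.

Definition entry (A : seq (seq zpoly)) (i j : nat) : zpoly :=
  nth [::] (nth [::] A i) j.

Definition pivot_row (r : seq zpoly) : bool :=
  match head [::] r with
  | [:: Zpos xH] | [:: Zneg xH] => true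
  | _ => false
  end.

(** A pivot 1 or -1 is its own inverse, so [c] is an exact quotient. Changing only rows below p
    makes the operation lower unitriangular. *)
Definition eliminate n (A : seq (seq zpoly)) : seq (seq zpoly) :=
  let p := find pivot_row A in
  [seq let c := zpmul (entry A i 0) (entry A p 0) in
       if (p < i)%N && ~~ zpzero c
       then [seq zptrim (zpsub (entry A i j) (zpmul c (entry A p j))) | j <- iota 0 n]
       else nth [::] A i | i <- iota 0 n].

Definition laplace_term (D : seq (seq zpoly) -> zpoly) (B : seq (seq zpoly))
    (i : nat) : zpoly :=
  let h := entry B i 0 in
  if zpzero h then [::] else
  zpmul (if odd i then zpopp h else h)
       (D [seq behead r | r <- take i B ++ drop i.+1 B]).

(* Laplace expansion along the first column, after clearing it with an entry 1 or
   -1 whenever there is one (otherwise eliminate changes nothing: the pivot index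
   is then out of range). *)
Fixpoint zpdet n (A : seq (seq zpoly)) : zpoly :=
  if n is n'.+1 then
    let B := eliminate n A in
    foldr zpadd [::] [seq laplace_term (zpdet n') B i | i <- iota 0 n]
  else [:: Zpos xH].

Definition evmx x n A : 'M[rat]_n := \matrix_(i, j) ev x (entry A i j).

Lemma det_eliminate x n A : \det (evmx x n (eliminate n A)) = \det (evmx x n A).
Proof.
set p := find pivot_row A.
pose c (i : nat) := zpmul (entry A i 0) (entry A p 0).
pose L : 'M[rat]_n := \matrix_(i, k)
  ((i == k)%:R - (if (p < i)%N && (k == p :> nat) then ev x (c i) else 0)).
suff -> : evmx x n (eliminate n A) = L *m evmx x n A.
  rewrite det_mulmx det_trig.
    rewrite big1 ?mul1r // => i _; rewrite mxE eqxx.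
    by case: eqP => [->|_]; rewrite ?ltnn ?andbF subr0.
  apply/is_trig_mxP => i k lt_ik; rewrite mxE -val_eqE (ltn_eqF lt_ik) add0r.
  case: ifP => [/andP[lt_pi /eqP k_p]|_]; last by rewrite oppr0.
  by rewrite k_p ltnNge ltnW in lt_ik.
apply/matrixP => i j; rewrite [RHS]mxE.
under eq_bigr do rewrite [L _ _]mxE mulrBl.
rewrite sumrB (bigD1 i) //= eqxx mul1r big1 ?addr0 => [|k /negPf ne_ki]; last first.
  by rewrite eq_sym ne_ki mul0r.
rewrite !mxE /entry /eliminate -/p (nth_map 0%N) ?size_iota // nth_iota // add0n.
have -> : ev x (nth [::] (nth [::] A i) j) = ev x (entry A i j) by [].
have sumE : \sum_(k < n) (if (p < i)%N && (k == p :> nat) then ev x (c i) else 0) *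
      evmx x n A k j =
    (if (p < i)%N then ev x (c i) * ev x (entry A p j) else 0).
  case: ltnP => [lt_pi|_] /=; last by rewrite big1 // => k _; rewrite mul0r.
  have lt_pn := ltn_trans lt_pi (ltn_ord i).
  rewrite (bigD1 (Ordinal lt_pn)) //= eqxx mxE big1 ?addr0 // => k.
  by rewrite -val_eqE /= => /negPf ->; rewrite mul0r.
rewrite {}sumE -/(c i).
case: ltnP => _ /=; last by rewrite subr0.
case: ifP => [_|/negbFE c0]; last by rewrite (ev_zero _ _ c0) mul0r subr0.
by rewrite (nth_map 0%N) ?size_iota // nth_iota // add0n ev_trim ev_sub ev_mul.
Qed.

Lemma ev_sum x (s : seq zpoly) :
  ev x (foldr zpadd [::] s) = \sum_(p <- s) ev x p.
Proof.
by elim: s => [|p s IH] /=; rewrite ?big_nil // big_cons ev_add IH.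
Qed.

Lemma det_evmx x n A : \det (evmx x n A) = ev x (zpdet n A).
Proof.
elim: n A => [|n IH] A; first by rewrite det_mx00 /=; ring.
rewrite -det_eliminate (expand_det_col _ 0).
rewrite -[zpdet _ _]/(foldr zpadd [::]
  [seq laplace_term (zpdet n) (eliminate n.+1 A) i | i <- index_iota 0 n.+1]).
rewrite ev_sum big_map big_mkord; set B := eliminate n.+1 A.
apply: eq_bigr => i _; rewrite mxE /laplace_term; case: ifP => [h0|_].
  by rewrite (ev_zero _ _ h0) mul0r.
rewrite ev_mul -IH /cofactor addn0.
have -> : ev x (if odd i then zpopp (entry B i 0) else entry B i 0) =
    ev x (entry B i 0) * (-1) ^+ i.
  by rewrite -signr_odd; case: odd; rewrite ?ev_opp ?expr1 ?expr0; ring.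
rewrite -mulrA; congr (_ * (_ * \det _)).
apply/matrixP => k l; rewrite !mxE /entry.
have sz_B : size B = n.+1 by rewrite size_map size_iota.
rewrite (nth_map [::]) => [|]; last first.
  by rewrite size_cat size_takel ?size_drop sz_B; case: i k => i ? [k ?] /=; lia.
have le_in : (i <= size B)%N by rewrite sz_B ltnW.
rewrite nth_behead nth_cat size_takel //= /bump.
case: ltnP => [lt_ki|le_ik]; first by rewrite nth_take.
by rewrite nth_drop addSn subnKC.
Qed.

(** * Classes modulo V_6 *)

(* With 'X - 1 = 2 cos t, cheb m is sin ((m+1) t) / sin t, and the roots of cheb 6
   are the t = k pi / 7, 0 < k < 7. *)
Definition cheb_red (m : nat) : {poly rat} :=
  let s := (m %% 14)%N in
  if (s < 6)%N then cheb s else if (6 < s < 13)%N then - cheb (12 - s) else 0.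

(** [cheb_red] satisfies the recurrence of [cheb] up to a multiple of [cheb 6]. *)
Lemma cheb_redP m : cheb 6 %| cheb m - cheb_red m.
Proof.
elim/cheb_ind: m => [||k IH0 IH1]; try by rewrite subrr dvdp0.
suff red_rec : cheb 6 %| cheb_red k.+2 - ('X - 1) * cheb_red k.+1 + cheb_red k.
  have -> : cheb k.+2 - cheb_red k.+2 = ('X - 1) * (cheb k.+1 - cheb_red k.+1)
      - (cheb k - cheb_red k)
      - (cheb_red k.+2 - ('X - 1) * cheb_red k.+1 + cheb_red k).
    by rewrite chebSS; ring.
  by apply: dvdp_sub red_rec; apply: dvdp_sub IH0; apply: dvdp_mull.
rewrite /cheb_red -(addn2 k) -(addn1 k) -(modnDml k 1) -(modnDml k 2).
have : (k %% 14 < 14)%N by rewrite ltn_mod.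
have dvdE c p : p = c * cheb 6 -> cheb 6 %| p by move=> ->; exact: dvdp_mull.
(* The defect is [- cheb 6] at residue 4, [cheb 6] at residue 6, and 0 otherwise. *)
move: (k %% 14)%N; do 14 (case=> [_|]; first by
  first [ apply: (dvdE 0); rewrite mul0r /=; ring
        | apply: (dvdE 1); rewrite mul1r /=; ring
        | apply: (dvdE (-1)); rewrite mulN1r /=; ring]).
by [].
Qed.

Lemma modp_cheb m : cheb m %% cheb 6 = cheb_red m.
Proof.
have [mon6 sz6] := monic_size_cheb 6.
rewrite -{1}(subrK (cheb_red m) (cheb m)) modpD (modp_eq0P _ _ (cheb_redP m)).
rewrite add0r modp_small // sz6 /cheb_red.
have sz s : (s < 6)%N -> (size (cheb s) < 7)%N.
  by case: (monic_size_cheb s) => _ ->.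
case: ifP => [/sz //|_]; case: ifP => [lt_s|_]; last by rewrite size_poly0.
by rewrite size_polyN sz //; lia.
Qed.

Definition red_coord (s j : nat) : Z :=
  if (s < 6)%N then (if s == j then Zpos xH else Z0)
  else if (6 < s < 13)%N then (if (12 - s)%N == j then Zneg xH else Z0)
  else Z0.

(** By orthonormality, pairing with V_j reads off the coordinate along V_j. *)
Lemma mom_cheb_red m j :
  mom (cheb_red m * cheb j) = zrat (red_coord (m %% 14) j).
Proof.
rewrite /cheb_red /red_coord.
case: ifP => _; first by rewrite cheb_orthonormal; case: eqP.
case: ifP => _; last by rewrite mul0r linear0.
by rewrite mulNr linearN /= cheb_orthonormal; case: eqP; rewrite ?oppr0.
Qed.

(* Coefficients modulo x^6 *)
Delimit Scope Z_scope with coqZ.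

(** Denominators 1, 1, 2, 2, 24, 120, stored as their cofactors in 120. *)
Definition codenom (l : nat) : nat := nth 1%N [:: 120; 120; 60; 60; 5; 1]%N l.

(* Entry (s, l) is 120 / codenom l times the coefficient of 'X^l in
   cheb (3 * k + s), as a polynomial in k; the period is 3 since 'X = 0 corresponds
   to t = 2 pi / 3. *)
Definition taylor_table : seq (seq zpoly) := ([::
 [:: [:: 1]; [:: 0; 1]; [:: 0; -3; -3]; [:: 0; 2; 1; -1];
     [:: 0; -22; -9; 22; 9]; [:: 0; 96; 30; -105; -30; 9]];
 [:: [:: -1]; [:: 1; 1]; [:: 0; 3; 3]; [:: 0; -3; -4; -1];
     [:: 0; 26; 21; -14; -9]; [:: 0; -114; -75; 105; 75; 9]];
 [:: [::]; [:: -2; -2]; [:: 2; 2]; [:: 0; 4; 6; 2];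
     [:: 0; -40; -60; -20]; [:: 0; 148; 150; -70; -90; -18]]])%coqZ.

Definition taylor_entry (s l : nat) : zpoly := nth [::] (nth [::] taylor_table s) l.

Definition taylor (s l : nat) : zpoly :=
  zpscale (Z.of_nat (codenom l)) (taylor_entry s l).

Definition cheb_step (a b : nat -> zpoly) (l : nat) : zpoly :=
  zpsub (zpsub (if l is l'.+1 then b l' else [::]) (b l)) (a l).

Definition shift1 (p : zpoly) : zpoly := zpcomp p [:: Zpos xH; Zpos xH].

(** These are polynomial identities in k, so one check proves the recurrence for all k. Going past s
    = 2 replaces k by k + 1, hence [shift1]. *)
Lemma taylor_table_step :
  all (fun l => [&&
      zpzero (zpsub (taylor 2 l) (cheb_step (taylor 0) (taylor 1) l)),
      zpzero (zpsub (shift1 (taylor 0 l)) (cheb_step (taylor 1) (taylor 2) l)) &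
      zpzero (zpsub (shift1 (taylor 1 l))
        (cheb_step (taylor 2) (fun i => shift1 (taylor 0 i)) l))]) (iota 0 6).
Proof. by vm_compute. Qed.

Lemma coef_chebSS m l :
  (cheb m.+2)`_l =
  (if l is l'.+1 then (cheb m.+1)`_l' else 0) - (cheb m.+1)`_l - (cheb m)`_l.
Proof. by rewrite chebSS mulrBl mul1r !coefB coefXM; case: l. Qed.

Lemma coef_cheb k s l : (s < 3)%N -> (l < 6)%N ->
  120%:R * (cheb (3 * k + s))`_l = ev k%:R (taylor s l).
Proof.
pose repr x m a := forall l, (l < 6)%N -> 120%:R * (cheb m)`_l = ev x (a l).
have step x m a b c : repr x m a -> repr x m.+1 b ->
    (forall l, (l < 6)%N -> zpzero (zpsub (c l) (cheb_step a b l))) ->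
    repr x m.+2 c.
  move=> ra rb c0 {}l lt_l; move/(ev_zero x): (c0 l lt_l).
  rewrite ev_sub => /eqP; rewrite subr_eq0 => /eqP ->.
  rewrite /cheb_step !ev_sub coef_chebSS !mulrBr ra // rb //.
  by case: l lt_l => [|l] lt_l; rewrite ?mulr0 // rb // ltnW.
have check := allP taylor_table_step.
have shiftE j p : ev j%:R (shift1 p) = ev j.+1%:R p.
  by rewrite ev_comp /= -natr1; congr ev; ring.
have repr2 j : repr j%:R (3 * j)%N (taylor 0) ->
    repr j%:R (3 * j).+1 (taylor 1) -> repr j%:R (3 * j).+2 (taylor 2).
  move=> r0 r1; apply: step r0 r1 _ => i lt_i.
  by have /check/and3P[] : i \in iota 0 6 by rewrite mem_iota.
have [r0 r1] : repr k%:R (3 * k)%N (taylor 0) /\ repr k%:R (3 * k).+1 (taylor 1).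
  elim: k => [|k [r0 r1]].
    split; do 6 (case=> [_|]; first by rewrite /= ?coefB ?coefX ?coef1 /=; ring);
    by [].
  have r2 := repr2 k r0 r1.
  have r3 : repr k%:R (3 * k).+3 (fun i => shift1 (taylor 0 i)).
    apply: step r1 r2 _ => i lt_i.
    by have /check/and3P[] : i \in iota 0 6 by rewrite mem_iota.
  have r4 : repr k%:R (3 * k).+4 (fun i => shift1 (taylor 1 i)).
    apply: step r2 r3 _ => i lt_i.
    by have /check/and3P[] : i \in iota 0 6 by rewrite mem_iota.
  rewrite mulnS add3n; split=> i lt_i; first by rewrite r3 // shiftE.
  by rewrite r4 // shiftE.
case: s => [|[|[|//]]] _ lt_l; rewrite ?addn0 ?addn1 ?addn2.
- exact: r0.
- exact: r1.
exact: repr2.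
Qed.

(** * The 12 x 12 determinants *)

(* The factor 120 / codenom l clears the denominators of the Taylor coefficients;
   their product 11520 cancels in hankel_eval. *)
Definition functional (j : 'I_12) (p : {poly rat}) : rat :=
  if (j < 6)%N then mom ((p %% cheb 6) * cheb j)
  else 120%:R / (codenom (j - 6))%:R * p`_(j - 6).

(* The residue of 21 * n + r + k modulo 14 depends on n only through its parity b. *)
Definition window (b : bool) (r : nat) : seq (seq zpoly) :=
  [seq [seq [:: red_coord ((7 * b + r + k) %% 14) j] | j <- iota 0 6] ++
       [seq zptrim (zpcomp (taylor_entry ((r + k) %% 3) l)
                [:: Z.of_nat ((r + k) %/ 3); 7%coqZ])
       | l <- iota 0 6]
  | k <- iota 0 12].

Lemma zrat_nat n : zrat (Z.of_nat n) = n%:R.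
Proof. by rewrite zratE -[Z.of_nat _]/(Z_of_int (Posz _)) Z_of_intK. Qed.

Lemma functional_cheb n r :
  \det (\matrix_(k < 12, j < 12) functional j (cheb (21 * n + r + k)%N)) =
  ev n%:R (zpdet 12 (window (odd n) r)).
Proof.
rewrite -det_evmx; congr (\det _); apply/matrixP => k j; rewrite !mxE.
rewrite /entry /window (nth_map 0%N) ?size_iota // nth_iota // add0n.
rewrite nth_cat size_map size_iota /functional; case: ltnP => [lt_j|le_j].
  rewrite (nth_map 0%N) ?size_iota // nth_iota // add0n modp_cheb mom_cheb_red /=.
  rewrite mulr0 addr0; congr (zrat (red_coord _ _)).
  by rewrite -{1}(odd_double_half n); lia.
have lt_j : (j - 6 < 6)%N by have := ltn_ord j; lia.
rewrite (nth_map 0%N) ?size_iota // nth_iota // add0n ev_trim ev_comp /=.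
(* The table index is 7n plus the quotient of r + k by 3, hence linear in n. *)
have -> : (21 * n + r + k = 3 * (7 * n + (r + k) %/ 3) + (r + k) %% 3)%N by lia.
have cod0 : (codenom (j - 6))%:R != 0 :> rat.
  by rewrite pnatr_eq0; case: (j - 6)%N lt_j => [|[|[|[|[|[|]]]]]].
rewrite mulrAC coef_cheb ?ltn_mod // ev_scale zrat_nat mulrC mulKf //.
by rewrite zrat_nat; congr ev; rewrite natrD natrM; ring.
Qed.

(** The polynomial for 180 (-1)^n H_(21n+r), read off at even n; 180 is the common denominator of
    the closed forms. *)
Definition hankel_zpoly (r : nat) : zpoly :=
  zptrim [seq Z.div (180 * a) 11520 | a <- zpdet 12 (window false r)]%coqZ.

(** The normalising determinant of V_0, ..., V_11, to be cancelled in Christoffel's identity. The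
    sums in [zpdet] are not trimmed, whence the trailing zeros. *)
Lemma zpdet_window0 : zpdet 12 (window false 0) = 11520%coqZ :: nseq 6 Z0.
Proof. by vm_compute. Qed.

(** Stated without division, the check also certifies that the quotients in [hankel_zpoly] are
    exact. Both parities share one polynomial up to sign. *)
Lemma zpdet_window :
  all (fun r => all (fun b : bool =>
    zpzero (zpsub (zpscale 180%coqZ (zpdet 12 (window b r)))
      (zpscale (if b then - 11520 else 11520)%coqZ (hankel_zpoly r))))
    [:: false; true]) (iota 0 21).
Proof. by vm_compute. Qed.

Lemma functional_is_scalar j : scalar (functional j).
Proof.
move=> a u v; rewrite /functional; case: ifP => _.
  by rewrite modpD modpZl mulrDl -scalerAl linearP.
by rewrite coefD coefZ mulrDr mulrCA.
Qed.

(** The first six functionals vanish on multiples of V_6, the last six on multiples of x^6. *)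
Lemma functional_ideal j p : functional j (p * ('X^6 * cheb 6)) = 0.
Proof.
rewrite /functional; case: ltnP => [_|le_j].
  by rewrite mulrA modp_mull mul0r linear0.
rewrite mulrCA coefXnM ltn_subLR //.
by rewrite (ltn_ord j) mulr0.
Qed.

Lemma hankel_christoffel N :
  hankel (fps_exp motzkin 7) N *
    \det (\matrix_(k < 12, j < 12) functional j (cheb k)) =
  \det (\matrix_(k < 12, j < 12) functional j (cheb (N + k)%N)).
Proof.
have [mon6 sz6] := monic_size_cheb 6.
have mon_q : 'X^6 * cheb 6 \is monic by rewrite monicMl ?monicXn.
have sz_q : size ('X^6 * cheb 6) = 13.
  by rewrite size_monicM ?monicXn ?monic_neq0 // size_polyXn sz6.
rewrite -(christoffel N 12 _ functional isT mon_q sz_q functional_is_scalar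
  functional_ideal).
congr (\det _ * _); apply/matrixP => i j; rewrite !mxE fps_exp_motzkin.
by rewrite mulrA -exprD mom_Xn_cheb.
Qed.

(** Christoffel's identity divided by the normalising determinant. As D and a are variables, [field]
    treats their images as atoms. *)
Lemma hankel_eval r n (D a : Z) p : zrat D != 0 -> zrat a != 0 ->
  zpdet 12 (window false 0) = D :: nseq 6 Z0 ->
  zpzero (zpsub (zpscale a (zpdet 12 (window (odd n) r)))
    (zpscale (if odd n then Z.opp D else D) p)) ->
  hankel (fps_exp motzkin 7) (21 * n + r)%N = (-1) ^+ n / zrat a * ev n%:R p.
Proof.
move=> D0 a0 det0 /(ev_zero n%:R).
rewrite ev_sub !ev_scale -functional_cheb -hankel_christoffel => /eqP.
have := functional_cheb 0 0; rewrite det0 muln0 !add0n => ->.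
rewrite [ev 0%:R _]/= mul0r addr0 subr_eq0 => /eqP eq_D.
apply: (mulIf D0); apply: (mulfI a0); rewrite {}eq_D.
have -> : zrat (if odd n then Z.opp D else D) = (-1) ^+ n * zrat D.
  by rewrite -signr_odd; case: odd; rewrite ?zratN ?mulN1r ?mul1r.
by field.
Qed.

Lemma hankelE r n : (r < 21)%N ->
  hankel (fps_exp motzkin 7) (21 * n + r)%N =
  (-1) ^+ n / 180%:R * ev n%:R (hankel_zpoly r).
Proof.
move=> lt_r; have r21 : r \in iota 0 21 by rewrite mem_iota.
have b2 : odd n \in [:: false; true] by case: odd.
have z180 : 180%:R = zrat 180%coqZ by rewrite /=; ring.
rewrite z180.
apply: hankel_eval zpdet_window0 (allP (allP zpdet_window r r21) (odd n) b2);
  by rewrite zratE intr_eq0.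
Qed.

(** * The closed forms *)

(* The restricted reduction keeps the large nat numerals from unfolding. *)
Ltac compute_clause HE :=
  match goal with |- hankel _ (_ + ?r)%N = _ =>
    rewrite (HE r isT);
    let v := eval vm_compute in (hankel_zpoly r) in
    rewrite (_ : hankel_zpoly r = v); last by vm_compute
  end;
  cbn [ev foldr zrat prat]; by field.

Theorem theorem5 (n : nat) :
  let H (m : nat) : rat := hankel (fps_exp motzkin 7) m in
  let x : rat := n%:R in
  (H (21 * n)%N = (-1) ^+ n) /\
  (H (21 * n + 1)%N = (-1) ^+ n) /\
  (H (21 * n + 2)%N = (-1) ^+ n.+1 * (7 / 30) * (2 * x + 1) *
     (374556%:R * x ^+ 4 + 385532%:R * x ^+ 3 + 127449%:R * x ^+ 2 + 13363%:R * x + 60)) /\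
  (H (21 * n + 3)%N = (-1) ^+ n * (49 / 180) *
     (29647548%:R * x ^+ 6 + 54252996%:R * x ^+ 5 + 27993259%:R * x ^+ 4
      + 2344748%:R * x ^+ 3 - 1393217%:R * x ^+ 2 - 227934%:R * x - 1080%:R)
     * (2 * x + 1) ^+ 2) /\
  (H (21 * n + 4)%N = (-1) ^+ n.+1 * (343 / 180) * (2 * x + 1) ^+ 3 *
     (4235364%:R * x ^+ 6 + 12706092%:R * x ^+ 5 + 12161065%:R * x ^+ 4
      + 3145310%:R * x ^+ 3 - 906059%:R * x ^+ 2 - 361032%:R * x + 3420%:R)) /\
  (H (21 * n + 5)%N = (-1) ^+ n.+1 * (49 / 180) *
     (29647548%:R * x ^+ 6 + 123632292%:R * x ^+ 5 + 201441499%:R * x ^+ 4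
      + 160049288%:R * x ^+ 3 + 61715353%:R * x ^+ 2 + 9000600%:R * x - 123300%:R)
     * (2 * x + 1) ^+ 2) /\
  (H (21 * n + 6)%N = (-1) ^+ n.+1 * (7 / 30) *
     (374556%:R * x ^+ 4 + 1112692%:R * x ^+ 3 + 1218189%:R * x ^+ 2 + 583163%:R * x
      + 103170%:R) * (2 * x + 1)) /\
  (H (21 * n + 7)%N = (-1) ^+ n.+1) /\
  (H (21 * n + 8)%N = (-1) ^+ n.+1) /\
  (H (21 * n + 9)%N = (-1) ^+ n * (7 / 30) * (x + 1) *
     (749112%:R * x ^+ 4 + 1850828%:R * x ^+ 3 + 1698242%:R * x ^+ 2 + 686273%:R * x
      + 103230%:R)) /\
  (H (21 * n + 10)%N = (-1) ^+ n.+1 * (49 / 180) * (x + 1) ^+ 2 *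
     (118590192%:R * x ^+ 6 + 375938976%:R * x ^+ 5 + 459474568%:R * x ^+ 4
      + 261223312%:R * x ^+ 3 + 59779951%:R * x ^+ 2 - 1682814%:R * x - 1959840%:R)) /\
  (H (21 * n + 11)%N = (-1) ^+ n * (343 / 90) * (x + 1) ^+ 3 *
     (16941456%:R * x ^+ 6 + 84707280%:R * x ^+ 5 + 148881208%:R * x ^+ 4
      + 115228792%:R * x ^+ 3 + 34672057%:R * x ^+ 2 - 1047963%:R * x - 1697400%:R)) /\
  (H (21 * n + 12)%N = (-1) ^+ n * (2401%:R / 15) * (x + 1) ^+ 4 *
     (115248%:R * x ^+ 4 + 460992%:R * x ^+ 3 + 587608%:R * x ^+ 2 + 288512%:R * x
      + 43695%:R)) /\
  (* The sign is opposite to that at index 21 * n + 16: H 13 = 537824. *)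
  (H (21 * n + 13)%N = (-1) ^+ n * 537824%:R * (x + 1) ^+ 5) /\
  (H (21 * n + 14)%N = 0) /\
  (H (21 * n + 15)%N = 0) /\
  (H (21 * n + 16)%N = (-1) ^+ n.+1 * 537824%:R * (x + 1) ^+ 5) /\
  (H (21 * n + 17)%N = (-1) ^+ n * (2401%:R / 15) * (x + 1) ^+ 4 *
     (115248%:R * x ^+ 4 + 460992%:R * x ^+ 3 + 587608%:R * x ^+ 2 + 217952%:R * x
      - 26865%:R)) /\
  (H (21 * n + 18)%N = (-1) ^+ n.+1 * (343 / 90) * (x + 1) ^+ 3 *
     (16941456%:R * x ^+ 6 + 118590192%:R * x ^+ 5 + 318295768%:R * x ^+ 4
      + 398162632%:R * x ^+ 3 + 205815337%:R * x ^+ 2 - 2633505%:R * x - 27024030%:R)) /\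
  (H (21 * n + 19)%N = (-1) ^+ n.+1 * (49 / 180) * (x + 1) ^+ 2 *
     (118590192%:R * x ^+ 6 + 1047143328%:R * x ^+ 5 + 3815496328%:R * x ^+ 4
      + 7351444912%:R * x ^+ 3 + 7906357711%:R * x ^+ 2 + 4503507834%:R * x
      + 1062057240%:R)) /\
  (H (21 * n + 20)%N = (-1) ^+ n.+1 * (7 / 30) * (x + 1) *
     (749112%:R * x ^+ 4 + 4142068%:R * x ^+ 3 + 8571962%:R * x ^+ 2 + 7868343%:R * x
      + 2702820%:R)).
Proof.
move=> H x.
have HE r : (r < 21)%N -> hankel (fps_exp motzkin 7) (21 * n + r)%N =
    (-1) ^+ n / 180%:R * ev x (hankel_zpoly r) by exact: hankelE.
(* Index 21n is read as 21n + 0, the shape that [compute_clause] matches. *)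
rewrite {}/H !(exprS _ n) -[in X in X /\ _](addn0 (21 * n)%N).
(* Each clause becomes a rational identity in the independent variables x and [sgn]. *)
clearbody x; move: ((-1) ^+ n) HE => sgn HE.
do 20 (split; first compute_clause HE); compute_clause HE.
Qed.
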